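(* Let $\kappa$ be a cardinal with $2^\kappa = \kappa^+$. Let $X$ and $Y$ be isodyne topological spaces such that $\{|X|, \mathrm{cf}|X|\} \cap \{\kappa, \kappa^+\} \ne \emptyset$ and $\mathrm{cf}|Y| = \kappa^+$. Then the product space $X \times Y$ is $\kappa^+$-resolvable.
   Context: For a topological space $Z$, the dispersion character is $\Delta(Z) = \min\{|U| : U \text{ is a nonempty open subset of } Z\}$. A space $Z$ is isodyne if $|Z| = \Delta(Z)$. For a cardinal $\tau$, a space $Z$ is $\tau$-resolvable if $Z$ can be partitioned into $\tau$-many (pairwise disjoint) dense subsets. $\mathrm{cf}$ denotes cofinality and $\kappa^+$ is the successor cardinal of $\kappa$. No separation axioms are assumed. *)

(* Defs.v *)
From mathcomp Require Import all_boot all_classical wochoice topology.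

Set Implicit Arguments.
Unset Strict Implicit.
Unset Printing Implicit Defensive.

Local Open Scope classical_set_scope.
Local Open Scope card_scope.

(** Following [mathcomp.classical.cardinality], cardinals are handled
    relationally: a cardinal is given by any set (or the full set of any type)
    of that cardinality, and finite cardinals are allowed. *)

Definition card_lt T U (A : set T) (B : set U) : Prop :=
  A #<= B /\ ~ (B #<= A).

(** |B| = |A|^+ : the cardinal of B is the least one above that of A. *)
Definition is_succ_card T U (A : set T) (B : set U) : Prop :=
  card_lt A B /\ forall V (C : set V), card_lt A C -> B #<= C.

(** |A| = min {|B| : B \in F}, the minimum being attained. *)
Definition is_min_card T U (F : set (set T)) (A : set U) : Prop :=
  (exists2 B, F B & B #= A) /\ forall B, F B -> A #<= B.

(** R well-orders T in the order type of the initial ordinal of |T|, i.e. every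
    proper initial segment of T has cardinality smaller than |T|. *)
Definition initial_well_order T (R : rel T) : Prop :=
  well_order R /\ forall x, card_lt [set y | R y x /\ y <> x] [set: T].

Definition cofinal T (R : rel T) (C : set T) : Prop :=
  forall x, exists2 y, C y & R x y.

(** |A| = cf |T|. The relation R below exists for every T and is unique up to
    isomorphism, so that quantifying over it existentially is harmless. *)
Definition is_cofinality T U (A : set U) : Prop :=
  exists2 R : rel T, initial_well_order R & is_min_card (cofinal R) A.
Arguments is_cofinality T {U} A.

(** |A| is the dispersion character of Z; this forces Z to be nonempty. *)
Definition is_dispersion_character (Z : topologicalType) U (A : set U) : Prop :=
  is_min_card [set O : set Z | open O /\ O !=set0] A.
Arguments is_dispersion_character Z {U} A.

Definition isodyne (Z : topologicalType) : Prop :=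
  is_dispersion_character Z [set: Z].

(** Z is |I|-resolvable. The members of a [partition] are nonempty and pairwise
    disjoint, so there are exactly |I| of them. *)
Definition resolvable (I : Type) (Z : topologicalType) : Prop :=
  exists2 D : I -> set Z,
    partition [set: I] D [set: Z] & forall i, dense (D i).

(* Main.v *)
Require Import Defs.
From Stdlib Require Import Wellfounded.
From mathcomp Require Import all_boot finmap all_classical wochoice topology.

Set Implicit Arguments.
Unset Strict Implicit.
Unset Printing Implicit Defensive.

Local Open Scope classical_set_scope.
Local Open Scope card_scope.

(** Write [K] and [L] for sets of cardinality kappa and kappa^+. Since [X] and
    [Y] are isodyne, every nonempty open subset of [X * Y] contains a rectangle
    with sides of cardinality |X| and |Y|. So it suffices to colour [X * Y] with
    the colours [L] in such a way that every such rectangle receives every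
    colour; the colour classes are then pairwise disjoint dense sets
    ([resolvable_prod]).

    Both spaces are first mapped to [L]. If cf |Y| = kappa^+, sending each point
    to a larger element of a cofinal set of minimal size gives [q : Y -> L] such
    that [q @` V] has size kappa^+ as soon as |V| = |Y|: a set of full size is
    cofinal, hence so is its image, and a cofinal set cannot be smaller than the
    cofinality ([cofinality_map]). In the same way, each of the four hypotheses
    on [X] gives [p : X -> L] such that [p @` U] has size at least kappa when
    |U| = |X| ([large_image_map]).

    It remains to find [c : L -> L -> L] taking every value on every [A * B]
    with |A| >= kappa and |B| = kappa^+ ([rectangle_colouring]); then
    [c (p x) (q y)] is the required colouring. As 2^kappa = kappa^+, there are
    only kappa^+ injections [K -> L], so these can be coded by elements of [L],
    itself well-ordered with all initial segments of size at most kappa. For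
    each [b] in [L] only kappa^2 = kappa pairs (injection, colour) lie below
    [b], so an injective selection of points from the ranges of these injections
    allows the column [c _ b] to take on each range every colour below [b].
    Given [A], [B] and a colour [g], choose an injection into [A] and an element
    [b] of [B] above its code and above [g].

    The cardinal arithmetic behind this rests on one recursion along a
    well-order, [greedy_choice]: a point can be picked greedily from each of a
    family of sets, without repetition, provided no set of the family is
    exhausted by the earlier picks. It yields the comparability of cardinals
    ([card_le_total]), kappa^2 = kappa ([card_square]) and the injective
    selection ([injective_selection]).

    If kappa^+ is finite, then so is cf |Y|, and a finite cofinality is at most
    1 ([cofinality_finite]); there is a single colour and nothing to do. *)

(** * Cardinal inequalities *)

Lemma inj_on_card_le T U (f : T -> U) (A : set T) (B : set U) :
  {homo f : x / A x >-> B x} ->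
  (forall x y, A x -> A y -> f x = f y -> x = y) -> A #<= B.
Proof.
move=> fAB finj.
have /injfunPex[g] : exists2 f : T -> U, set_fun A B f & set_inj A f.
  by exists f => // x y /set_mem Ax /set_mem Ay; exact: finj.
exact: inj_card_le.
Qed.

Lemma card_setT_leP T U (B : set U) :
  [set: T] #<= B -> exists2 f : T -> U, injective f & forall x, B (f x).
Proof.
move=> /card_leP[f]; exists (fun x => val (f (to_setT x))).
- move=> x y /val_inj /(@inj _ _ _ f); rewrite !inE => /(_ I I).
  by move/(congr1 val).
- by move=> x; exact: set_valP.
Qed.

Lemma card_setX_le T U T' U' (A : set T) (B : set U) (A' : set T')
    (B' : set U') :
  A #<= A' -> B #<= B' -> A `*` B #<= A' `*` B'.
Proof.
rewrite -(card_le_eql (card_setT A)) -(card_le_eql (card_setT B)).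
move=> /card_setT_leP[f finj fA] /card_setT_leP[g ginj gB].
pose h (p : set_type A * set_type B) := (f p.1, g p.2).
apply: (@card_le_trans _ _ _ [set: set_type A * set_type B]); last first.
  apply: (@inj_on_card_le _ _ h) => [[a b] _|[a b] [a' b'] _ _ []].
    by split; [exact: fA | exact: gB].
  by move=> /finj -> /ginj ->.
rewrite -[X in X #<= _]/(A `*` B).
have -> : A `*` B = (fun p : set_type A * set_type B => (val p.1, val p.2)) @`
    setT.
  apply/seteqP; split => [[a b] [/= /mem_set Aa /mem_set Bb]|_ [[a b] _ <-]].
    by exists (exist _ a Aa, exist _ b Bb).
  by split; exact: set_valP.
exact: card_image_le.
Qed.

(** Hilbert's hotel: a copy of [nat] inside [A] makes room for [a]. *)
Lemma card_setU1_infinite T (A : set T) (a : T) :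
  infinite_set A -> a |` A #<= A.
Proof.
move=> Ainf; have [aA|naA] := pselect (A a).
  by apply: subset_card_le => x [->|].
have /infiniteP/card_setT_leP[f finj fA] := Ainf.
(* X and a |` X are both countably infinite, and A \ X is left in place. *)
pose X := range f.
have Xnat : X #= [set: nat] by rewrite (card_eql (inj_card_eq (in2W finj))).
have aXnat : a |` X #= [set: nat].
  apply: eq_card_nat.
    have -> : a |` X = range (oapp f a).
      apply/seteqP; split => [_ [->|[n _ <-]]|_ [[n|] _ <-]] /=.
      - by exists None.
      - by exists (Some n).
      - by right; exists n.
      - by left.
    exact: card_le_trans (card_image_le _ _) (countableP _).
  apply/infiniteP.
  apply: card_le_trans (subset_card_le (@subsetUr _ [set a] X)).
  by rewrite -(card_le_eql Xnat).
have : X #= a |` X by rewrite (card_eqr aXnat).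
elim/Ppointed: T => T in A a Ainf naA f finj fA X Xnat aXnat *.
  by case: (no a).
move=> /pcard_eqP[h].
have XA : X `<=` A by move=> _ [n _ <-].
have [|g _] := super_bij h XA (@setUS _ [set a] _ _ XA).
  have -> : (a |` A) `\` (a |` X) = A `\` X; last exact: card_eqxx.
  apply/seteqP; split => x [].
    by move=> [->|Ax] nX; [case: nX; left | split => // Xx; apply: nX; right].
  by move=> Ax nX; split; [right | case=> [xa|//]; apply: naA; rewrite -xa].
have : A #= a |` A by exact: pcard_eq g.
by rewrite card_eq_le => /andP[].
Qed.

(** * Strict well-orders *)

Definition segment T (lt : T -> T -> Prop) (x : T) : set T := [set y | lt y x].

(** Transitivity is not part of the definition: a well-founded relation has no
    cycle of length two or three, so it follows from trichotomy
    ([swo_trans]). *)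
Definition strict_well_order T (lt : T -> T -> Prop) : Prop :=
  well_founded lt /\ forall x y, [\/ x = y, lt x y | lt y x].

Section StrictWellOrder.
Context (T : Type) (lt : T -> T -> Prop).
Hypothesis lt_wo : strict_well_order lt.

Lemma swo_asym x y : lt x y -> ~ lt y x.
Proof.
move: x y; apply: (well_founded_ind lt_wo.1) => x IH y xy yx.
exact: (IH _ yx _ yx xy).
Qed.

Lemma swo_trans x y z : lt x y -> lt y z -> lt x z.
Proof.
move: x y z; have [wf tri] := lt_wo.
apply: (well_founded_ind wf) => x IH y z xy yz.
have [xz|//|zx] := tri x z; first by case: (swo_asym xy); rewrite xz.
by case: (swo_asym yz); exact: (IH _ zx _ _ zx xy).
Qed.

End StrictWellOrder.

Lemma swo_inverse_image T U (f : T -> U) (lt : U -> U -> Prop) :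
  injective f -> strict_well_order lt ->
  strict_well_order (fun x y => lt (f x) (f y)).
Proof.
move=> finj [wf tri]; split; first exact: wf_inverse_image.
by move=> x y; case: (tri (f x) (f y)) => [/finj|?|?];
  [constructor 1|constructor 2|constructor 3].
Qed.

Lemma swo_lexicographic T U (ltT : T -> T -> Prop) (ltU : U -> U -> Prop) :
  strict_well_order ltT -> strict_well_order ltU ->
  strict_well_order (fun p q : T * U =>
    ltT p.1 q.1 \/ p.1 = q.1 /\ ltU p.2 q.2).
Proof.
move=> [wfT triT] [wfU triU]; split.
  case=> x; elim/(well_founded_ind wfT): x => x IHx y.
  elim/(well_founded_ind wfU): y => y IHy.
  by constructor => -[x' y'] /= [/IHx//|[-> /IHy]].
move=> [x y] [x' y']; case: (triT x x') => [<-|?|?].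
- case: (triU y y') => [<-|?|?].
  + by constructor 1.
  + by constructor 2; right.
  + by constructor 3; right.
- by constructor 2; left.
- by constructor 3; left.
Qed.

(** The minimum of the pair {x, y}; reflexivity and totality are read off
    it. *)
Lemma well_order_pair_min T (R : rel T) : well_order R ->
  forall x y, exists2 z, z = x \/ z = y & R z x /\ R z y.
Proof.
move=> Rwo x y.
have [|z [[/asboolP zxy zmin] _]] := Rwo (fun z => `[< z = x \/ z = y >]).
  by exists x; apply/asboolP; left.
by exists z => //; split; apply: zmin; apply/asboolP; [left|right].
Qed.

Lemma well_order_refl T (R : rel T) : well_order R -> reflexive R.
Proof. by move=> Rwo x; have [z [->|->] []] := well_order_pair_min Rwo x x. Qed.

Lemma well_order_total T (R : rel T) : well_order R -> total R.
Proof.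
move=> Rwo x y; apply/orP.
by have [z [->|->] []] := well_order_pair_min Rwo x y; [left|right].
Qed.

Lemma well_order_antisymmetric T (R : rel T) : well_order R -> antisymmetric R.
Proof.
move=> Rwo x y /andP[xy yx].
have [|z [_ zuniq]] := Rwo (fun z => `[< z = x \/ z = y >]).
  by exists x; apply/asboolP; left.
have minE w : w = x \/ w = y -> minimum_of R (fun z => `[< z = x \/ z = y >]) w.
  move=> wxy; split; first exact/asboolP.
  by move=> v /asboolP[->|->]; case: wxy => ->; rewrite ?well_order_refl.
by rewrite -(zuniq x)?(zuniq y)//; apply: minE; [right|left].
Qed.

Lemma well_order_strict T (R : rel T) : well_order R ->
  strict_well_order (fun x y => R x y /\ x <> y).
Proof.
move=> Rwo; split; last first.
  move=> x y; have [->|xy] := pselect (x = y); first by constructor 1.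
  by case/orP: (well_order_total Rwo x y) => ?;
    [constructor 2|constructor 3; split => // yx; apply: xy].
move=> x; apply: contrapT => nAx.
have [|z [[/asboolP nAz zmin] _]] :=
  Rwo (fun z => `[< ~ Acc (fun x y => R x y /\ x <> y) z >]).
  by exists x; apply/asboolP.
apply: nAz; constructor => y [yz neq]; apply: contrapT => nAy.
apply: neq; apply: well_order_antisymmetric Rwo _ _ _.
by rewrite yz zmin//; exact/asboolP.
Qed.

Lemma strict_well_order_exists T :
  exists lt : T -> T -> Prop, strict_well_order lt.
Proof.
have [R Rwo] := well_ordering_principle {classic T}.
by exists (fun x y => R x y /\ x <> y); exact: well_order_strict.
Qed.

Definition initial_order T (lt : T -> T -> Prop) : Prop :=
  strict_well_order lt /\ forall x, ~ ([set: T] #<= segment lt x).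

(** Take any well-order of [T]. If some initial segment is as large as [T], the
    least such segment receives an injection from [T]; the order pulled back
    along it has only segments that embed in smaller ones. *)
Lemma initial_order_exists T : exists lt : T -> T -> Prop, initial_order lt.
Proof.
have [lt lt_wo] := strict_well_order_exists T.
have [noinit|] := pselect (forall x, ~ ([set: T] #<= segment lt x)).
  by exists lt.
move=> /existsNP[x0 /contrapT x0T].
have [x [xT xmin]] : exists x, [set: T] #<= segment lt x /\
    forall y, lt y x -> ~ ([set: T] #<= segment lt y).
  elim/(well_founded_ind lt_wo.1): x0 x0T => x IH xT.
  have [?|] := pselect (forall y, lt y x -> ~ ([set: T] #<= segment lt y)).
    by exists x.
  by move=> /existsNP[y /not_implyP[yx /contrapT]]; exact: IH.
have [f finj fx] := card_setT_leP xT.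
exists (fun a b => lt (f a) (f b)); split; first exact: swo_inverse_image.
move=> a aT; apply: (xmin (f a)); first exact: fx.
apply: card_le_trans aT _.
by apply: (inj_on_card_le (f := f)) => // u v _ _ /finj.
Qed.

(** * Greedy choice *)

(** The recursion picks for [r i] an element of [E i] distinct from all the
    earlier picks; these form an image of [segment lt i], which is too small to
    contain [E i]. *)
Lemma greedy_choice I T (lt : I -> I -> Prop) (E : I -> set T) :
  strict_well_order lt -> (forall i, ~ (E i #<= segment lt i)) ->
  exists2 r : I -> T, injective r & forall i, E i (r i).
Proof.
elim/Ppointed: T => T in E * => lt_wo Ebig.
  (* The sets E i are empty, hence dominated by any segment: I is empty. *)
  have noI (i : I) : False by apply: (Ebig i); rewrite emptyE.
  by exists (fun i => False_rect T (noI i)) => i; case: (noI i).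
pose F i (rec : forall j, lt j i -> T) : T :=
  xget point [set x | E i x /\ forall j (ji : lt j i), rec j ji <> x].
pose r := Fix lt_wo.1 (fun _ => T) F.
have rE i : r i = xget point [set x | E i x /\ forall j, lt j i -> r j <> x].
  rewrite /r Fix_eq// => j f g fg; congr F.
  apply: functional_extensionality_dep => k.
  by apply: functional_extensionality_dep => kj; exact: fg.
have rP i : E i (r i) /\ forall j, lt j i -> r j <> r i.
  rewrite rE; case: xgetP => // noneP.
  case: (Ebig i); apply: card_le_trans (card_image_le r (segment lt i)).
  apply: subset_card_le => x Ex; apply: contrapT => nrx; apply: (noneP x).
  by split=> // j ji rjx; apply: nrx; exists j.
exists r => [i j rij|i]; last exact: (rP i).1.
case: (lt_wo.2 i j) => // [ij|ji].
- by case: ((rP j).2 _ ij).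
- by case: ((rP i).2 _ ji).
Qed.

(** Enumerating [T] along an initial order, with values in [U], never runs out
    of elements of [U]. *)
Lemma card_setT_le_total T U :
  ~ ([set: U] #<= [set: T]) -> [set: T] #<= [set: U].
Proof.
have [lt [lt_wo _]] := initial_order_exists T => nUT.
have [|r rinj _] := greedy_choice (E := fun=> [set: U]) lt_wo.
  by move=> i /card_le_trans /(_ (card_leT _)).
by apply: (inj_on_card_le (f := r)) => // x y _ _ /rinj.
Qed.

Lemma card_le_total T U (A : set T) (B : set U) : ~ (B #<= A) -> A #<= B.
Proof.
rewrite -(card_le_eql (card_setT B)) -(card_le_eqr (card_setT A)).
move=> /card_setT_le_total.
by rewrite (card_le_eql (card_setT A)) (card_le_eqr (card_setT B)).
Qed.

(** In an order of [I] pulled back from an initial order of [K], each element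
    comes after fewer than |K| others. *)
Lemma injective_selection I K T (E : I -> set T) :
  [set: I] #<= [set: K] -> (forall i, [set: K] #<= E i) ->
  exists2 r : I -> T, injective r & forall i, E i (r i).
Proof.
move=> /card_setT_leP[f finj _] Ebig.
have [lt [lt_wo ltK]] := initial_order_exists K.
apply: (greedy_choice (lt := fun i j => lt (f i) (f j))).
  exact: swo_inverse_image.
move=> i Ei; apply: (ltK (f i)); apply: card_le_trans (Ebig i) _.
apply: card_le_trans Ei _.
by apply: (inj_on_card_le (f := f)) => // u v _ _ /finj.
Qed.

(** * Squares of infinite cardinals *)

Lemma initial_order_closed_segment T (lt : T -> T -> Prop) (m : T) :
  initial_order lt -> infinite_set [set: T] ->
  ~ ([set: T] #<= m |` segment lt m).
Proof.
move=> [_ ini] Tinf Tm; apply: (ini m); apply: card_le_trans (Tm) _.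
apply: card_setU1_infinite => segfin; apply: Tinf.
by apply: card_le_finite Tm _; rewrite finite_setU.
Qed.

Definition square_absorbing T (A : set T) := infinite_set A -> A `*` A #<= A.

Lemma square_absorbing_eq T U (A : set T) (B : set U) :
  A #= B -> square_absorbing A -> square_absorbing B.
Proof.
rewrite card_eq_le => /andP[AB BA] sqA Binf.
apply: card_le_trans (card_setX_le BA BA) _; apply: card_le_trans _ AB.
by apply: sqA => /(card_le_finite BA).
Qed.

(** Goedel's order on pairs, by maximum and then lexicographically: the pairs
    below [p] lie in the square of a closed initial segment of [T], so there
    are fewer than |T| of them, and [T * T] can be enumerated injectively in
    [T]. *)
Lemma square_absorbing_initial T (lt : T -> T -> Prop) :
  initial_order lt -> (forall x, square_absorbing (segment lt x)) ->
  square_absorbing [set: T].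
Proof.
move=> ini sq Tinf; have [lt_wo segT] := ini; have [wf tri] := lt_wo.
pose mx (p : T * T) := if pselect (lt p.1 p.2) then p.2 else p.1.
pose g (p : T * T) := (mx p, p).
have mxP p : (p.1 = mx p \/ lt p.1 (mx p)) /\ (p.2 = mx p \/ lt p.2 (mx p)).
  rewrite /mx; case: pselect => /= [?|np]; split; try by [left|right].
  by case: (tri p.1 p.2) => // [->|]; [left|right].
have ginj : injective g by move=> p q [].
have godel_wo := swo_inverse_image ginj
  (swo_lexicographic lt_wo (swo_lexicographic lt_wo lt_wo)).
have [|r rinj _] := greedy_choice (E := fun=> [set: T]) godel_wo; last first.
  by apply: (inj_on_card_le (f := r)) => // x y _ _ /rinj.
move=> p Tp; set m := mx p; set S := m |` segment lt m.
have TSS : [set: T] #<= S `*` S.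
  apply: card_le_trans Tp _; apply: subset_card_le => q /= gq.
  have qm : mx q = m \/ lt (mx q) m by case: gq => [|[]]; [right|left].
  have SP x : x = mx q \/ lt x (mx q) -> S x.
    rewrite /S /=; case=> [->|xq]; first by case: qm; [left|right].
    by right; case: qm => [<-//|]; exact: swo_trans xq.
  by split; apply: SP; apply mxP.
have [Sfin|Sinf] := pselect (finite_set S).
  by apply: Tinf; apply: card_le_finite TSS _; exact: finite_setX.
have seginf : infinite_set (segment lt m).
  by move=> segfin; apply: Sinf; rewrite finite_setU.
have Sseg : S #<= segment lt m by exact: card_setU1_infinite.
apply: (segT m); apply: card_le_trans TSS _.
by apply: card_le_trans (card_setX_le Sseg Sseg) _; exact: sq.
Qed.

(** A well-order which is not initial has a segment equinumerous to the whole
    type, whose square is already known. *)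
Lemma square_absorbing_swo T (lt : T -> T -> Prop) :
  strict_well_order lt -> (forall x, square_absorbing (segment lt x)) ->
  square_absorbing [set: T].
Proof.
move=> lt_wo sq.
have [ini|] := pselect (forall x, ~ ([set: T] #<= segment lt x)).
  by move=> noseg; exact: (square_absorbing_initial (lt := lt)).
move=> /existsNP[x /contrapT xT]; apply: square_absorbing_eq (sq x).
by rewrite card_eq_le xT card_leT.
Qed.

(** Hessenberg's theorem, by induction along the segments of a well-order. *)
Lemma card_square T : infinite_set [set: T] -> [set: T * T] #<= [set: T].
Proof.
rewrite -setXTT; have [lt lt_wo] := strict_well_order_exists T.
apply: (square_absorbing_swo lt_wo) => x.
elim/(well_founded_ind lt_wo.1): x => x IH.
apply: square_absorbing_eq (card_setT _) _.
pose lt' (u v : set_type (segment lt x)) := lt (val u) (val v).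
have lt'_wo : strict_well_order lt'.
  by apply: swo_inverse_image => //; exact: val_inj.
apply: (square_absorbing_swo lt'_wo) => u.
have ux : lt (val u) x by exact: (set_valP u).
apply: square_absorbing_eq (IH _ ux).
have -> : segment lt (val u) = val @` segment lt' u.
  apply/seteqP; split=> [y yu|_ [v vu <-]//].
  by exists (exist _ y (mem_set (swo_trans lt_wo yu ux))).
by apply: inj_card_eq => v w _ _; exact: val_inj.
Qed.

(** * A colouring of kappa^+ * kappa^+ *)

(** (kappa^+)^kappa = 2^(kappa * kappa) = kappa^+. The map [J] is a coding of
    the functions [K -> L] by elements of [L]. *)
Lemma card_fun_succ K L :
  infinite_set [set: K] -> [set: K -> bool] #= [set: L] ->
  exists J : (K -> L) -> L, injective J.
Proof.
move=> Kinf; rewrite card_eq_le => /andP[/card_setT_leP[b binj _]].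
move=> /card_setT_leP[a ainj _].
have /card_setT_leP[i iinj _] := card_square Kinf.
exists (fun h => b (fun k => `[< exists2 p, i p = k & a (h p.1) p.2 >])).
move=> h h' /binj hh'; apply: funext => k; apply: ainj; apply: funext => l.
have codeE (g : K -> L) :
    `[< exists2 p, i p = i (k, l) & a (g p.1) p.2 >] = a (g k) l.
  by apply/asboolP/idP => [[p /iinj -> //]|akl]; exists (k, l).
by rewrite -!codeE (congr1 (fun f => f (i (k, l))) hh').
Qed.

Lemma card_lt_succ K L V (S : set V) :
  is_succ_card [set: K] [set: L] -> ~ ([set: L] #<= S) -> S #<= [set: K].
Proof.
move=> [_ Lmin] LS; apply: contrapT => SK; apply: LS; apply: Lmin.
by split=> //; exact: card_le_total.
Qed.

(** The successor of a finite cardinal [n] is at most [n.+1]. *)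
Lemma succ_card_infinite K L :
  is_succ_card [set: K] [set: L] -> infinite_set [set: L] ->
  infinite_set [set: K].
Proof.
move=> [_ Lmin] Linf [n Kn]; apply: Linf.
apply: (card_le_finite (B := `I_n.+1)); last exact: finite_II.
apply: Lmin; split; rewrite ?(card_le_eql Kn) ?(card_le_eqr Kn) card_le_II //.
by rewrite ltnn.
Qed.

(** The column at [b] handles the requirements (h, g), meaning that the colour
    [g] must appear on the range of the injection [h], for which both the code
    of [h] and [g] are below [b]. There are at most |K| of them and each range
    has |K| elements, so distinct requirements can be given distinct points. *)
Lemma rectangle_colouring K L :
  infinite_set [set: L] -> is_succ_card [set: K] [set: L] ->
  [set: K -> bool] #= [set: L] ->
  exists c : L -> L -> L, forall A B : set L,
    [set: K] #<= A -> [set: L] #<= B ->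
    forall g, exists a b, [/\ A a, B b & c a b = g].
Proof.
move=> Linf Lsucc Lpow; have Kinf := succ_card_infinite Lsucc Linf.
have [J Jinj] := card_fun_succ Kinf Lpow.
have [lt lt_ini] := initial_order_exists L; have [lt_wo ltL] := lt_ini.
have /choice[c cP] : forall b, exists cb : L -> L, forall h g,
    injective h -> lt (J h) b -> lt g b -> exists k : K, cb (h k) = g.
  move=> b; pose Q (p : (K -> L) * L) :=
    [/\ injective p.1, lt (J p.1) b & lt p.2 b].
  have segK : segment lt b #<= [set: K] by exact: card_lt_succ (ltL b).
  have QK : [set: {p | Q p}] #<= [set: K].
    apply: (@card_le_trans _ _ _ (segment lt b `*` segment lt b)).
      apply: (inj_on_card_le (f := fun u : {p | Q p} =>
        (J (sval u).1, (sval u).2))).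
        by move=> [p [? ? ?]] _.
      move=> [[h g] Qp] [[h' g'] Qp'] _ _ /= [/Jinj hh' gg'].
      by subst h' g'; congr exist; exact: Prop_irrelevance.
    apply: card_le_trans (card_setX_le segK segK) _.
    by rewrite setXTT; exact: card_square.
  have [|r rinj rE] := injective_selection
      (E := fun u : {p | Q p} => range (sval u).1) QK.
    move=> [[h g] [/= hinj _ _]]; apply: (inj_on_card_le (f := h)).
      by move=> k _; exists k.
    by move=> k l _ _ /hinj.
  (* As r is injective, a point serves one requirement at most; the colour of
     the other points is arbitrary. *)
  have /choice[cb cbP] : forall a, exists g,
      forall u, r u = a -> (sval u).2 = g.
    move=> a; have [[u ua]|nu] := pselect (exists u, r u = a).
      by exists (sval u).2 => v va; congr (sval _).2; apply: rinj; rewrite va.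
    by exists a => u ua; case: nu; exists u.
  exists cb => h g hinj hb gb.
  pose u : {p | Q p} := exist _ (h, g) (And3 hinj hb gb).
  by have [k _ hk] := rE u; exists k; rewrite -(cbP (h k) u).
exists (fun a b => c b a) => A B /card_setT_leP[h hinj hA] LB g.
pose closed m := m |` segment lt m.
(* Otherwise B would lie weakly below the maximum of J h and g. *)
have [b Bb [hb gb]] : exists2 b, B b & lt (J h) b /\ lt g b.
  apply: contrapT => nB.
  have Bsub : exists m, B `<=` closed m.
    have trich (x b : L) : ~ lt x b -> closed x b.
      by case: (lt_wo.2 x b) => [->|//|]; [left|right].
    have closed_le x y b : closed x b -> x = y \/ lt x y -> closed y b.
      move=> xb [<-//|xy]; right; case: xb => [->//|bx].
      exact: swo_trans lt_wo _ _ _ bx xy.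
    have [m Jm gm] : exists2 m, J h = m \/ lt (J h) m & g = m \/ lt g m.
      case: (lt_wo.2 (J h) g) => [->|?|?];
        by [exists g; auto|exists (J h); auto].
    exists m => b Bb; have [Jb|/trich Jb] := pselect (lt (J h) b).
      apply: closed_le gm; apply: trich => gb; apply: nB.
      by exists b.
    exact: closed_le Jb Jm.
  have [m Bm] := Bsub.
  apply: (initial_order_closed_segment (m := m) lt_ini Linf).
  exact: card_le_trans LB (subset_card_le Bm).
have [k ckb] := cP b h g hinj hb gb.
by exists (h k), b.
Qed.

(** * Cofinality *)

(** A set that is not cofinal lies in a proper initial segment. *)
Lemma cofinal_of_full_card T (R : rel T) (V : set T) :
  initial_well_order R -> [set: T] #<= V -> cofinal R V.
Proof.
move=> [Rwo Rini] TV x; apply: contrapT => nV.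
apply: (Rini x).2; apply: card_le_trans TV _; apply: subset_card_le => v Vv.
have nxv : ~ R x v by move=> xv; apply: nV; exists v.
split; last by move=> vx; apply: nxv; rewrite vx; exact: well_order_refl.
by have /orP[|//] := well_order_total Rwo v x.
Qed.

Lemma well_order_trans T (R : rel T) : well_order R ->
  forall x y z, R x y -> R y z -> R x z.
Proof.
move=> Rwo x y z xy yz; have [-> //|neqxy] := pselect (x = y).
have [<- //|neqyz] := pselect (y = z).
by have [] := swo_trans (well_order_strict Rwo) (conj xy neqxy) (conj yz neqyz).
Qed.

(** Send a point to an element above it in a cofinal set [C] of size |U|. The
    elements of [C] reached from [V] are again cofinal when [V] has full size,
    so by minimality there are |U| of them. *)
Lemma cofinality_map T U : is_cofinality T [set: U] ->
  exists q : T -> U, forall V : set T, [set: T] #<= V -> [set: U] #<= q @` V.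
Proof.
move=> [R Rini [[C Ccof CU] Cmin]].
have [g ginj _] : exists2 g : set_type C -> U,
    injective g & forall u, setT (g u).
  apply: card_setT_leP; rewrite (card_le_eql (card_setT C)).
  by move: CU; rewrite card_eq_le => /andP[].
have /choice[d dP] : forall y, exists c : set_type C, R y (val c).
  by move=> y; have [c /mem_set Cc yc] := Ccof y; exists (exist _ c Cc).
exists (g \o d) => V /(cofinal_of_full_card Rini) Vcof.
rewrite -image_comp (card_le_eqr (inj_card_eq (in2W ginj))).
apply: card_le_trans (card_image_le val _); apply: Cmin => x.
have [v Vv xv] := Vcof x; exists (val (d v)).
  by exists (d v) => //; exists v.
exact: well_order_trans Rini.1 _ _ _ xv (dP v).
Qed.

Lemma finite_card_setD1 T (A : set T) (x : T) :
  finite_set A -> A x -> ~ (A #<= A `\ x).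
Proof.
elim/Pchoice: T => T in A x * => -[n An] Ax AAx.
have finA : finite_set A by exists n.
have finAx : finite_set (A `\ x) by exact: sub_finite_set finA.
have := leq_card_fset_set finAx (n := n).
rewrite -(card_le_eql An) => /(_ AAx).
by rewrite fset_setD1// leqNgt -[n](card_fset_set An) (cardfsD1 x (fset_set A))
  in_fset_set// mem_set// ltnS leqnn.
Qed.

(** Removing from a cofinal set an element which is not its maximum leaves it
    cofinal, which contradicts the minimality of a finite cofinal set with two
    elements. *)
Lemma cofinality_finite T U : is_cofinality T [set: U] ->
  finite_set [set: U] -> forall u v : U, u = v.
Proof.
move=> [R [Rwo _] [[C Ccof CU] Cmin]] Ufin.
have Cfin : finite_set C by rewrite (eq_finite_set CU).
have chain_le c1 c2 : C c1 -> C c2 -> R c1 c2 -> c1 = c2.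
  move=> Cc1 Cc2 c12; apply: contrapT => neq.
  apply: (finite_card_setD1 Cfin Cc1); rewrite (card_le_eql CU).
  apply: Cmin => x.
  have [y Cy xy] := Ccof x.
  have [yc1|nyc1] := pselect (y = c1); last by exists y.
  exists c2; first by split=> // c21; apply: neq.
  by apply: well_order_trans Rwo _ _ _ xy _; rewrite yc1.
have [f finj fC] : exists2 f : U -> T, injective f & forall u, C (f u).
  by apply: card_setT_leP; move: CU; rewrite card_eq_le => /andP[].
move=> u v; apply: finj.
by case/orP: (well_order_total Rwo (f u) (f v)) => /chain_le -> //.
Qed.

(** * Resolvability of the product *)

Lemma isodyne_open_card (Z : topologicalType) (O : set Z) :
  isodyne Z -> open O -> O !=set0 -> [set: Z] #<= O.
Proof. by move=> [_ Zmin] Oopen On0; apply: Zmin. Qed.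

Lemma isodyne_nonempty (Z : topologicalType) : isodyne Z -> [set: Z] !=set0.
Proof. by move=> [[O [_ [z Oz]]] _ _]; exists z. Qed.

Lemma resolvable_prod (I : Type) (X Y : topologicalType) (c : X -> Y -> I) :
  [set: X] !=set0 -> [set: Y] !=set0 ->
  (forall (U : set X) (V : set Y), open U -> U !=set0 -> open V -> V !=set0 ->
    forall i, exists x y, [/\ U x, V y & c x y = i]) ->
  resolvable I (X * Y)%type.
Proof.
move=> X0 Y0 call; exists (fun i => [set p | c p.1 p.2 = i]).
  split; first by apply/seteqP; split => // p _; exists (c p.1 p.2).
    by move=> i j _ _ [p [/= -> ->]].
  move=> i _; have [x [y [_ _ cxy]]] := call _ _ openT X0 openT Y0 i.
  by exists (x, y).
move=> i O [p Op] Oopen.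
have /= [[U V] /= [pU pV] UVO] : nbhs p O by apply: open_nbhs_nbhs.
have [||||x [y [Ux Vy cxy]]] := call U^° V^° _ _ _ _ i.
- exact: open_interior.
- by exists p.1.
- exact: open_interior.
- by exists p.2.
exists (x, y); split => //; apply: UVO; split; exact: interior_subset.
Qed.

(** When |X| is kappa or kappa^+, a bijection is enough; otherwise
    [cofinality_map] applies. A map into [K] is composed with an injection of
    [K] in [L]. *)
Lemma large_image_map K L (X : Type) :
  [set: K] #<= [set: L] ->
  [\/ [set: X] #= [set: K], [set: X] #= [set: L],
      is_cofinality X [set: K] | is_cofinality X [set: L]] ->
  exists p : X -> L, forall U : set X, [set: X] #<= U -> [set: K] #<= p @` U.
Proof.
move=> KL; have [k kinj _] := card_setT_leP KL.
have eqcase M : [set: X] #= [set: M] -> exists p : X -> M, forall U : set X,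
    [set: X] #<= U -> [set: M] #<= p @` U.
  rewrite card_eq_le => /andP[/card_setT_leP[p pinj _] MX].
  exists p => U XU; rewrite (card_le_eqr (inj_card_eq (in2W pinj))).
  exact: card_le_trans MX XU.
have mapK : (exists p : X -> K, forall U : set X,
    [set: X] #<= U -> [set: K] #<= p @` U) ->
  exists p : X -> L, forall U : set X, [set: X] #<= U -> [set: K] #<= p @` U.
  move=> [p pP]; exists (k \o p) => U /pP KpU.
  by rewrite -image_comp (card_le_eqr (inj_card_eq (in2W kinj))).
have mapL : (exists p : X -> L, forall U : set X,
    [set: X] #<= U -> [set: L] #<= p @` U) ->
  exists p : X -> L, forall U : set X, [set: X] #<= U -> [set: K] #<= p @` U.
  by move=> [p pP]; exists p => U /pP; exact: card_le_trans.
case.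
- by move=> /eqcase/mapK.
- by move=> /eqcase/mapL.
- by move=> /cofinality_map/mapK.
- by move=> /cofinality_map/mapL.
Qed.

Theorem theorem6p1 (K Kplus : Type)
    (HKplus : is_succ_card [set: K] [set: Kplus])
    (Hpow : [set: K -> bool] #= [set: Kplus])
    (X Y : topologicalType)
    (HX : isodyne X) (HY : isodyne Y)
    (HcX : [\/ [set: X] #= [set: K], [set: X] #= [set: Kplus],
               is_cofinality X [set: K] | is_cofinality X [set: Kplus]])
    (HcY : is_cofinality Y [set: Kplus]) :
  resolvable Kplus (X * Y)%type.
Proof.
have X0 := isodyne_nonempty HX; have Y0 := isodyne_nonempty HY.
have [Lfin|Linf] := pselect (finite_set [set: Kplus]).
  have Leq := cofinality_finite HcY Lfin.
  have [g _ _] : exists2 g : (K -> bool) -> Kplus,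
      injective g & forall h, setT (g h).
    by apply: card_setT_leP; move: Hpow; rewrite card_eq_le => /andP[].
  apply: (resolvable_prod (c := fun _ _ => g xpredT)) => //.
  by move=> U V _ [x Ux] _ [y Vy] i; exists x, y; split.
have [c cP] := rectangle_colouring Linf HKplus Hpow.
have [p pP] := large_image_map HKplus.1.1 HcX.
have [q qP] := cofinality_map HcY.
apply: (resolvable_prod (c := fun x y => c (p x) (q y))) => //.
move=> U V Uopen U0 Vopen V0 i.
have pU := pP U (isodyne_open_card HX Uopen U0).
have qV := qP V (isodyne_open_card HY Vopen V0).
have [_ [_ [[x Ux <-] [y Vy <-] cxy]]] := cP _ _ pU qV i.
by exists x, y.
Qed.
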